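(* Assume there exist $\varepsilon_{\mathbb S}>0$ and a sequence $(a_n)_{n\ge1}$ of positive reals with $\sum_{n\ge1}a_n=\infty$ such that for every $(s,\varepsilon)\in\mathbb S\times(0,\varepsilon_{\mathbb S})$ and every bounded measurable $f:\mathbb X\to[0,+\infty)$, with $B:=B(s,\varepsilon)$, $$\mathbb E_{(\pi,0)}\big[f(X_n)\mathbf 1_B(S_n)\big]\sim a_n\,\pi(f)\,m_{\mathbb S}(B)\quad(n\to\infty). \tag{LL0}$$ Then (a) $\mathcal R_{(\pi,0)}=\mathbb S$; (b) if moreover $(X_n)_n$ is Harris recurrent, then $\mathcal R_{(\mu,0)}=\mathbb S$ for every probability measure $\mu$ on $(\mathbb X,\mathcal X)$.
   Context: $(\mathbb X,\mathcal X)$ is a measurable space. A Markov random walk (MRW) on $\mathbb X\times\mathbb R^2$ is a Markov chain $(X_n,S_n)_{n\ge0}$ with values in $\mathbb X\times\mathbb R^2$ whose transition kernel $P$ satisfies $P((x,s);A\times S)=P((x,0);A\times(S-s))$ for all $(x,s)\in\mathbb X\times\mathbb R^2$, $A\in\mathcal X$ and Borel $S\subset\mathbb R^2$; then $(X_n)_n$ is itself a Markov chain (the driving chain), with transition kernel denoted $Q$. One always takes $S_0=0$. For a probability measure $\mu$ on $\mathbb X$, $\mathbb P_{(\mu,0)}$ (expectation $\mathbb E_{(\mu,0)}$) is the law of the chain with $X_0\sim\mu$, $S_0=0$; $\mathbb P_{(x,0)}:=\mathbb P_{(\delta_x,0)}$. Standing assumptions: $Q$ has an invariant probability measure $\pi$;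 $S_1$ is $\mathbb P_{(\pi,0)}$-integrable with $\mathbb E_{(\pi,0)}[S_1]=0$; there is a two-dimensional closed subgroup $\mathbb S$ of $\mathbb R^2$ with $\mathbb P_{(x,0)}(S_n\in\mathbb S)=1$ for all $x\in\mathbb X$, $n\ge0$. $|\cdot|$ is the Euclidean norm, $B(s,\varepsilon)$ the open Euclidean ball, $m_{\mathbb S}$ a Haar measure on $\mathbb S$ (viewed as a measure on $\mathbb R^2$). The recurrence set is $\mathcal R_{(\mu,0)}:=\{s\in\mathbb S:\ \forall\varepsilon>0,\ \mathbb P_{(\mu,0)}(|S_n-s|<\varepsilon\text{ for infinitely many }n)=1\}$, $\mathcal R_{(x,0)}:=\mathcal R_{(\delta_x,0)}$. $(X_n)_n$ is Harris recurrent if for every $B\in\mathcal X$ with $\pi(B)>0$ and every $x\in\mathbb X$, $\mathbb P_{(x,0)}(X_k\in B\text{ for infinitely many }k)=1$. *)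

(* Defs.v *)
From HB Require Import structures.
From mathcomp Require Import all_boot all_order all_algebra.
From mathcomp Require Import all_classical all_reals all_analysis.
Set Implicit Arguments. Unset Strict Implicit. Unset Printing Implicit Defensive.
Import Order.TTheory GRing.Theory Num.Theory.
Local Open Scope classical_set_scope.
Local Open Scope ring_scope.

(** Points of R^2 are pairs (R * R); the measurable structure is the product
    of the Borel sigma-algebras (= Borel sigma-algebra of R^2). *)

Definition p2add (R : realType) (u v : (R * R)%type) : (R * R)%type :=
  (u.1 + v.1, u.2 + v.2).
Definition p2sub (R : realType) (u v : (R * R)%type) : (R * R)%type :=
  (u.1 - v.1, u.2 - v.2).

Definition enorm (R : realType) (u : (R * R)%type) : R :=
  Num.sqrt (u.1 ^+ 2 + u.2 ^+ 2).
Definition eball (R : realType) (s : (R * R)%type) (e : R) : set (R * R) :=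
  [set t | enorm (p2sub t s) < e].

Definition closed_subgroup2 (R : realType) (Sg : set (R * R)) : Prop :=
  [/\ closed (Sg : set (R^o * R^o)%type), Sg (0, 0),
      (forall u v, Sg u -> Sg v -> Sg (p2sub u v)) &
      exists u v, [/\ Sg u, Sg v & u.1 * v.2 - u.2 * v.1 != 0]].

Definition haar_on (R : realType) (Sg : set (R * R))
  (m : {measure set (R * R)%type -> \bar R}) : Prop :=
  [/\ m (~` Sg) = 0%E, (0 < m setT)%E,
      (forall s r, (m (eball s r) < +oo)%E) &
      (forall s A, Sg s -> measurable A ->
         m [set t | A (p2sub t s)] = m A)].

Definition Qker d (X : measurableType d) (R : realType)
  (P : R.-pker (X * (R * R))%type ~> (X * (R * R))%type) (x : X) (A : set X)
  : \bar R := P (x, (0, 0)) (A `*` setT).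

Definition pdirac d (X : measurableType d) (R : realType) (x : X)
  : probability X R := \d_x.

(** [is_MRW P Xc Sc law]: for every initial law mu on X, [law mu] is a
    probability on Om under which (Xc n, Sc n)_n is a Markov chain with
    transition kernel P started at X_0 ~ mu, S_0 = 0 (i.e. [law mu] is
    P_(mu,0)); and P is a Markov random walk kernel. The Markov property is
    expressed on the generating pi-system of sigma(Z_0,...,Z_n). *)
Definition is_MRW d (X : measurableType d) (R : realType)
  dO (Om : measurableType dO)
  (P : R.-pker (X * (R * R))%type ~> (X * (R * R))%type)
  (Xc : nat -> Om -> X) (Sc : nat -> Om -> (R * R)%type)
  (law : probability X R -> probability Om R) : Prop :=
  [/\ (forall n, measurable_fun setT (Xc n) /\ measurable_fun setT (Sc n)),
      (forall x s (A : set X) (B : set (R * R)), measurable A -> measurable B ->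
         P (x, s) (A `*` B) = P (x, (0, 0)) (A `*` [set t | B (p2add t s)])) &
      (forall mu : probability X R,
        (forall A, measurable A ->
           law mu [set w | A (Xc 0 w) /\ Sc 0 w = (0, 0)] = mu A) /\
        (forall n (B : nat -> set (X * (R * R))) (A : set (X * (R * R))),
           (forall k, measurable (B k)) -> measurable A ->
           law mu ([set w | forall k, (k <= n)%N -> B k (Xc k w, Sc k w)]
                   `&` [set w | A (Xc n.+1 w, Sc n.+1 w)])
           = (\int[law mu]_(w in [set w | forall k, (k <= n)%N ->
                                             B k (Xc k w, Sc k w)])
                P (Xc n w, Sc n w) A)%E))].

Definition harris_recurrent d (X : measurableType d) (R : realType)
  dO (Om : measurableType dO) (Xc : nat -> Om -> X)
  (law : probability X R -> probability Om R) (pi : probability X R) : Prop :=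
  forall (B : set X) (x : X), measurable B -> (0 < pi B)%E ->
    law (pdirac R x) [set w | forall N, exists k, (N <= k)%N /\ B (Xc k w)] = 1%E.

Definition rec_set dO (Om : measurableType dO) (R : realType)
  (Sc : nat -> Om -> (R * R)%type) (Sg : set (R * R)) (Pmu : probability Om R)
  : set (R * R) :=
  [set s | Sg s /\ forall eps : R, 0 < eps ->
     Pmu [set w | forall N, exists n, (N <= n)%N /\ enorm (p2sub (Sc n w) s) < eps]
     = 1%E].

(* Main.v *)
Require Import Defs.
From HB Require Import structures.
From mathcomp Require Import all_boot all_order all_algebra.
From mathcomp Require Import all_classical all_reals all_analysis.
From mathcomp Require Import measurable_realfun ring lra zify.
Import Order.TTheory GRing.Theory Num.Theory.
Import numFieldNormedType.Exports.
Local Open Scope classical_set_scope.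
Local Open Scope ring_scope.

(** Write [h x] for the probability that the walk started at [(x, 0)] never
    enters [B(s, e)] after time [N]. By the Markov property and translation
    invariance, [E_pi (h (X_n) 1_B(t, e/2) (S_n))] is at most the probability
    that the walk visits [B(t, e/2)] at time [n] and stays out of
    [B(s + t, e/2)] after time [n + N], whereas (LL0) says that it is equivalent
    to [a_n pi(h) m(B(t, e/2))], whose sum diverges unless [pi(h) = 0].

    For [s = t = 0] these events overlap at most [N + 1] times, so their
    probabilities have a bounded sum and the walk almost surely returns to every
    ball around 0 infinitely often. For arbitrary [s] and [t = -s] each of them
    has probability 0, since the walk does return near 0. Hence, for pi-almost
    every [x], the walk started at [(x, 0)] enters every rational ball meeting
    the group. A walk that reaches such points [x] infinitely often, by
    stationarity or by Harris recurrence, cannot have a last visit to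
    [B(s, e)]. *)

Set Implicit Arguments. Unset Strict Implicit. Unset Printing Implicit Defensive.

(** * Measures on products and integration against mixtures of measures *)

Lemma eq_measure_rectangles d1 d2 (T1 : measurableType d1)
    (T2 : measurableType d2) (R : realType)
    (m1 m2 : {measure set (T1 * T2) -> \bar R}) :
  (m1 setT < +oo)%E ->
  (forall A B, measurable A -> measurable B -> m1 (A `*` B) = m2 (A `*` B)) ->
  forall C, measurable C -> m1 C = m2 C.
Proof.
move=> m1oo m12.
pose G : set (set (T1 * T2)) := [set A `*` B | A in measurable & B in measurable].
apply: (measure_unique G (fun=> setT)).
- exact: measurable_prod_measurableType.
- move=> _ _ [A mA [B mB <-]] [A' mA' [B' mB' <-]].
  exists (A `&` A'); first exact: measurableI.
  exists (B `&` B'); first exact: measurableI.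
  by rewrite setXI.
- by move=> n; exists setT => //; exists setT => //; rewrite setXTT.
- by apply/seteqP; split => // x _; exists 0%N.
- by move=> _ [A mA [B mB <-]]; exact: m12.
- by [].
Qed.

Section mixture.
Import HBNNSimple.
Local Open Scope ereal_scope.
Context d2 (Z : measurableType d2) (R : realType).

Let nnsfun_mixtureE d1 (T : measurableType d1)
    (nu : {measure set T -> \bar R}) (D : set T)
    (k : T -> {measure set Z -> \bar R}) (f : {nnsfun Z >-> R}) :
  measurable D ->
  (forall A, measurable A -> measurable_fun [set: T] (fun t => k t A)) ->
  \int[nu]_(t in D) (\int[k t]_z (f z)%:E) =
  \sum_(r \in range f) (r%:E * \int[nu]_(t in D) k t (f @^-1` [set r])).
Proof.
move=> mD mk; under eq_integral do rewrite integralT_nnsfun sintegralE.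
rewrite ge0_integral_fsum//; last 2 first.
- move=> r; apply: measurable_funTS; apply: measurable_funeM; exact: mk.
- by move=> r t _; exact: nnsfun_mulemu_ge0.
apply: eq_fsbigr => r _.
have [r0|r0] := leP 0%R r.
  rewrite ge0_integralZl//.
  by apply: measurable_funTS; exact: mk.
(* For [r < 0] the preimage of [r] under the nonnegative [f] is empty, so both sides vanish. *)
rewrite integral0_eq; last by move=> t _; rewrite preimage_nnfun0// measure0 mule0.
rewrite integral0_eq ?mule0// => t _.
by rewrite preimage_nnfun0// measure0.
Qed.

(** Monotone convergence is used twice: for the inner integral at each [t], then for the outer
    one. *)
Let mixture_limE d1 (T : measurableType d1)
    (nu : {measure set T -> \bar R}) (D : set T)
    (k : T -> {measure set Z -> \bar R}) (f : Z -> \bar R)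
    (mf : measurable_fun setT f) :
  measurable D ->
  (forall A, measurable A -> measurable_fun [set: T] (fun t => k t A)) ->
  (forall z, 0 <= f z) ->
  let f_ := nnsfun_approx measurableT mf in
  \int[nu]_(t in D) (\int[k t]_z f z) =
  limn (fun n => \int[nu]_(t in D) (\int[k t]_z (f_ n z)%:E)).
Proof.
move=> mD mk f0 f_.
have nd z a b : (a <= b)%N -> (f_ a z)%:E <= (f_ b z)%:E.
  by move=> ab; rewrite lee_fin; exact/lefP/nd_nnsfun_approx.
have intE (mu : {measure set Z -> \bar R}) :
    \int[mu]_z f z = limn (fun n => \int[mu]_z (f_ n z)%:E).
  rewrite -monotone_convergence//.
  - by apply: eq_integral => z _; apply/esym/cvg_lim => //; exact: cvg_nnsfun_approx.
  - by move=> n; exact/measurable_EFinP.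
  - by move=> n z _; rewrite lee_fin.
  - by move=> z _ a b; exact: nd.
under eq_integral do rewrite intE.
rewrite monotone_convergence//.
- move=> n; apply: measurable_funTS; apply: measurable_fun_integral_kernel => //.
  + by move=> z; rewrite lee_fin.
  + exact/measurable_EFinP.
- by move=> n t _; apply: integral_ge0 => z _; rewrite lee_fin.
- move=> t _ a b ab; apply: ge0_le_integral => //.
  + by move=> z _; rewrite lee_fin.
  + exact/measurable_EFinP.
  + exact/measurable_EFinP.
  + by move=> z _; exact: nd.
Qed.

(** Approximation by simple functions reduces both iterated integrals to the values of the two
    mixtures on measurable sets, where they agree by assumption. *)
Lemma ge0_eq_integral_mixture d1 (T1 : measurableType d1)
    d1' (T2 : measurableType d1')
    (nu1 : {measure set T1 -> \bar R}) (nu2 : {measure set T2 -> \bar R})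
    (D1 : set T1) (D2 : set T2)
    (k1 : T1 -> {measure set Z -> \bar R}) (k2 : T2 -> {measure set Z -> \bar R})
    (f : Z -> \bar R) :
  measurable D1 -> measurable D2 ->
  (forall A, measurable A -> measurable_fun [set: T1] (fun t => k1 t A)) ->
  (forall A, measurable A -> measurable_fun [set: T2] (fun t => k2 t A)) ->
  (forall A, measurable A ->
    \int[nu1]_(t in D1) k1 t A = \int[nu2]_(t in D2) k2 t A) ->
  (forall z, 0 <= f z) -> measurable_fun setT f ->
  \int[nu1]_(t in D1) (\int[k1 t]_z f z) =
  \int[nu2]_(t in D2) (\int[k2 t]_z f z).
Proof.
move=> mD1 mD2 mk1 mk2 k12 f0 mf; 
rewrite (mixture_limE nu1 mf)// (mixture_limE nu2 mf)//=.
congr (limn _); apply/funext => n; rewrite !nnsfun_mixtureE//.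
by apply: eq_fsbigr => r _; rewrite k12.
Qed.

End mixture.

(** The left-hand side is an integral against the mixture of the Dirac masses at [Y1 t]. This form
    turns the Markov property, stated for sets, into one for functions. *)
Lemma ge0_integral_mixture d1 (T1 : measurableType d1)
    d2 (T2 : measurableType d2) d (Z : measurableType d) (R : realType)
    (nu1 : {measure set T1 -> \bar R}) (nu2 : {measure set T2 -> \bar R})
    (D1 : set T1) (Y1 : T1 -> Z) (k2 : T2 -> {measure set Z -> \bar R})
    (D2 : set T2) (f : Z -> \bar R) :
  measurable D1 -> measurable D2 -> measurable_fun setT Y1 ->
  (forall A, measurable A -> measurable_fun [set: T2] (fun t => k2 t A)) ->
  (forall A, measurable A ->
    nu1 (D1 `&` Y1 @^-1` A) = \int[nu2]_(t in D2) k2 t A)%E ->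
  (forall z, 0 <= f z)%E -> measurable_fun setT f ->
  (\int[nu1]_(t in D1) f (Y1 t) = \int[nu2]_(t in D2) (\int[k2 t]_z f z))%E.
Proof.
move=> mD1 mD2 mY1 mk2 Yk f0 mf.
transitivity (\int[nu1]_(t in D1) \int[\d_(Y1 t)]_z f z)%E.
  by apply: eq_integral => t _; rewrite integral_dirac// diracT mul1e.
apply: ge0_eq_integral_mixture => //.
  move=> A mA.
  exact: measurableT_comp (measurable_fun_dirac (D := setT) mA) mY1.
move=> A mA; rewrite -Yk//.
rewrite setIC -integral_indic//.
by rewrite -[X in measurable X]setTI; exact: mY1.
Qed.

(** A change of variable restricted to [D], because the initial position is 0 only on an almost sure
    event. *)
Lemma ge0_integral_same_law d1 (T1 : measurableType d1)
    d (Z : measurableType d) (R : realType)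
    (nu : {measure set T1 -> \bar R}) (mu : {measure set Z -> \bar R})
    (D : set T1) (Y : T1 -> Z) (f : Z -> \bar R) :
  measurable D -> measurable_fun setT Y ->
  (forall A, measurable A -> nu (D `&` Y @^-1` A) = mu A)%E ->
  (forall z, 0 <= f z)%E -> measurable_fun setT f ->
  (\int[nu]_(t in D) f (Y t) = \int[mu]_z f z)%E.
Proof.
move=> mD mY nuY f0 mf.
rewrite (ge0_integral_mixture (Y1 := Y) (nu2 := mu) (D2 := setT)
  (k2 := fun x => \d_x))//.
- by apply: eq_integral => x _; rewrite integral_dirac// diracT mul1e.
- by move=> A mA; exact: measurable_fun_dirac.
- by move=> A mA; rewrite nuY// integral_indic// setIT.
Qed.

(** * Probability that a Markov chain stays in prescribed sets *)

Section stay.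
Local Open Scope ereal_scope.
Context d (Z : measurableType d) (R : realType) (P : R.-pker Z ~> Z).
Implicit Types C : nat -> set Z.

(* Probability, for the chain with kernel [P] started at [z], that
   [Z_(k+1) \in C k] for all [k < j]. *)
Fixpoint stay C (j : nat) (z : Z) : \bar R :=
  if j is j'.+1 then \int[P z]_(y in C 0%N) stay (fun k => C k.+1) j' y else 1.

(** For measurable [C k] the sequence [stay C j z] is nonincreasing in [j], so the infimum is its
    limit: the probability that [Z_(k+1) \in C k] for all [k]. *)
Definition stay_forever C (z : Z) : \bar R := ereal_inf (range (stay C ^~ z)).

Lemma stay_ge0 C j z : 0 <= stay C j z.
Proof. by elim: j C z => [|j IH] C z //=; exact: integral_ge0. Qed.

Lemma measurable_stay C j : (forall k, measurable (C k)) ->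
  measurable_fun setT (stay C j).
Proof.
elim: j C => [|j IH] C mC /=; first exact: measurable_cst.
under eq_fun do rewrite integral_mkcond.
apply: measurable_fun_integral_kernel.
- by move=> U mU; exact: measurable_kernel.
- by move=> z; apply: erestrict_ge0 => ? _; exact: stay_ge0.
- apply/(measurable_restrictT _ (mC 0%N)); apply: measurable_funTS; exact: IH.
Qed.

Lemma stay_le1 C j z : (forall k, measurable (C k)) -> stay C j z <= 1.
Proof.
elim: j C z => [|j IH] C z mC //=.
apply: (@le_trans _ _ (\int[P z]_(y in C 0%N) cst 1 y)).
  apply: ge0_le_integral => //.
  - by move=> y _; exact: stay_ge0.
  - by apply: measurable_funTS; exact: measurable_stay.
  - by move=> y _; exact: IH.
rewrite integral_cst// mul1e -(prob_kernel (s := P) z).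
by apply: le_measure; rewrite ?inE.
Qed.

Lemma stayS_le C j z : (forall k, measurable (C k)) ->
  stay C j.+1 z <= stay C j z.
Proof.
elim: j C z => [|j IH] C z mC; first exact: (stay_le1 1 z mC).
rewrite [leLHS]/= [leRHS]/=; apply: ge0_le_integral => //.
- by move=> y _; exact: (stay_ge0 (fun k => C k.+1) j.+1 y).
- apply: measurable_funTS.
  exact: (@measurable_stay (fun k => C k.+1) j.+1).
- by apply: measurable_funTS; exact: measurable_stay.
- by move=> y _; exact: (IH (fun k => C k.+1)).
Qed.

Lemma stay_subset C C' j z : (forall k, measurable (C k)) ->
  (forall k, measurable (C' k)) -> (forall k, C k `<=` C' k) ->
  stay C j z <= stay C' j z.
Proof.
elim: j C C' z => [|j IH] C C' z mC mC' CC' //=.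
apply: (@le_trans _ _ (\int[P z]_(y in C 0%N) stay (fun k => C' k.+1) j y)).
  apply: ge0_le_integral => //.
  - by move=> y _; exact: stay_ge0.
  - by apply: measurable_funTS; exact: measurable_stay.
  - by apply: measurable_funTS; exact: measurable_stay.
  - by move=> y _; exact: IH.
apply: ge0_subset_integral => //.
- by apply: measurable_funTS; exact: measurable_stay.
- by move=> y _; exact: stay_ge0.
Qed.

Lemma cvg_stay C z : (forall k, measurable (C k)) ->
  stay C j z @[j --> \oo] --> stay_forever C z.
Proof.
move=> mC; apply: ereal_nonincreasing_cvgn.
by apply/nonincreasing_seqP => j; exact: stayS_le.
Qed.

Lemma stay_forever_ge0 C z : 0 <= stay_forever C z.
Proof. by apply: le_ereal_inf_tmp => _ [j _ <-]; exact: stay_ge0. Qed.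

Lemma stay_forever_le1 C z : stay_forever C z <= 1.
Proof. by apply: ereal_inf_lbound; exists 0%N. Qed.

Lemma measurable_stay_forever C : (forall k, measurable (C k)) ->
  measurable_fun setT (stay_forever C).
Proof.
move=> mC; apply: (@emeasurable_fun_cvg _ _ _ setT (stay C)).
  by move=> j; exact: measurable_stay.
by move=> z _; exact: cvg_stay.
Qed.

Lemma stay_forever_subset C C' z : (forall k, measurable (C k)) ->
  (forall k, measurable (C' k)) -> (forall k, C k `<=` C' k) ->
  stay_forever C z <= stay_forever C' z.
Proof.
move=> mC mC' CC'; apply: le_ereal_inf_tmp => _ [j _ <-].
apply: le_trans _ (stay_subset j z mC mC' CC').
by apply: ereal_inf_lbound; exists j.
Qed.

(** The kernel at [T z] is the image under [T] of the kernel at [z]; the change of variable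
    [y -> T y] in each of the [j] successive integrals gives the equality for every [j], before the
    infimum is taken. *)
Lemma stay_forever_equivariant (T : Z -> Z) C z : measurable_fun setT T ->
  (forall z A, measurable A -> P (T z) A = P z (T @^-1` A)) ->
  (forall k, measurable (C k)) ->
  stay_forever C (T z) = stay_forever (fun k => T @^-1` C k) z.
Proof.
move=> mT PT mC; rewrite /stay_forever; congr (ereal_inf (image _ _)).
apply/funext => j; elim: j C z mC => [//|j IH] C z mC.
rewrite [LHS]/= [RHS]/=.
transitivity (\int[P z]_(y in T @^-1` C 0%N) stay (fun k => C k.+1) j (T y)).
  2: by apply: eq_integral => y _; rewrite IH.
rewrite integral_mkcond [RHS]integral_mkcond.
transitivity (\int[P z]_y (stay (fun k => C k.+1) j \_ (C 0%N)) (T y)).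
  have f0 y : 0 <= (stay (fun k => C k.+1) j \_ (C 0%N)) y.
    by apply: erestrict_ge0 => ? _; exact: stay_ge0.
  have mf : measurable_fun setT (stay (fun k => C k.+1) j \_ (C 0%N)).
    apply/(measurable_restrictT _ (mC 0%N)); apply: measurable_funTS.
    exact: measurable_stay.
  rewrite -(@ge0_integral_pushforward _ _ _ _ _ T mT (P z) setT)//.
  by apply: eq_measure_integral => A mA _; rewrite PT.
by apply: eq_integral => y _; rewrite /patch; congr (if _ then _ else _).
Qed.

End stay.

(** * The Markov property, from one step to the whole future *)

Section markov.
Local Open Scope ereal_scope.
Context d (Z : measurableType d) (R : realType) (P : R.-pker Z ~> Z).
Context dO (Om : measurableType dO) (law : probability Om R).
Variable Zc : nat -> Om -> Z.
Implicit Types (B C : nat -> set Z) (n j : nat).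

Definition cylinder n B : set Om :=
  [set w | forall k, (k <= n)%N -> B k (Zc k w)].

Hypothesis mZ : forall n, measurable_fun setT (Zc n).
Hypothesis markov : forall n B A, (forall k, measurable (B k)) -> measurable A ->
  law (cylinder n B `&` [set w | A (Zc n.+1 w)]) =
  \int[law]_(w in cylinder n B) P (Zc n w) A.

Lemma measurable_hit n A : measurable A -> measurable [set w | A (Zc n w)].
Proof. by move=> mA; rewrite -[X in measurable X]setTI; exact: mZ. Qed.

Lemma measurable_cylinder n B : (forall k, measurable (B k)) ->
  measurable (cylinder n B).
Proof.
move=> mB; have -> : cylinder n B =
    \bigcap_(k in [set k | (k <= n)%N]) [set w | B k (Zc k w)] by [].
by apply: bigcap_measurableType => k _; exact: measurable_hit.
Qed.

Lemma markov_integral n B f : (forall k, measurable (B k)) ->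
  (forall z, 0 <= f z) -> measurable_fun setT f ->
  \int[law]_(w in cylinder n B) f (Zc n.+1 w) =
  \int[law]_(w in cylinder n B) (\int[P (Zc n w)]_z f z).
Proof.
move=> mB f0 mf.
apply: (ge0_integral_mixture (Y1 := Zc n.+1)
  (k2 := fun w => P (Zc n w))) => //.
- exact: measurable_cylinder.
- exact: measurable_cylinder.
- move=> A mA; exact: measurableT_comp (measurable_kernel P A mA) (mZ n).
- by move=> A mA; exact: markov.
Qed.

(** Induction on [j]: the first future constraint is absorbed into the past, which becomes a
    cylinder up to time [n.+1], and is then integrated out by the one-step property. *)
Lemma markov_stay j n B C : (forall k, measurable (B k)) ->
  (forall k, measurable (C k)) ->
  law (cylinder n B `&` [set w | forall k, (k < j)%N -> C k (Zc (n.+1 + k) w)]) =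
  \int[law]_(w in cylinder n B) stay P C j (Zc n w).
Proof.
elim: j n B C => [|j IH] n B C mB mC /=.
  rewrite integral_cst ?mul1e; last exact: measurable_cylinder.
  by congr (law _); apply/seteqP; split => [w []|w ?]//; split.
pose B' k := if (k <= n)%N then B k else C 0%N.
have mB' k : measurable (B' k) by rewrite /B'; case: ifP.
have cylS : cylinder n.+1 B' = cylinder n B `&` [set w | C 0%N (Zc n.+1 w)].
  apply/seteqP; split => w.
    move=> cw; split => [k kn|/=].
      by have := cw _ (leqW kn); rewrite /B' kn.
    by have := cw _ (leqnn _); rewrite /B' ltnn.
  move=> [cw C0] k; rewrite leq_eqVlt /B' => /predU1P[->|].
    by rewrite ltnn.
  by rewrite ltnS => kn; rewrite kn; exact: cw.
transitivity (law (cylinder n.+1 B' `&`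
    [set w | forall k, (k < j)%N -> C k.+1 (Zc (n.+2 + k) w)])).
  congr (law _); rewrite cylS -setIA; congr (_ `&` _).
  apply/seteqP; split => w.
    move=> Cw; split; first by have := Cw 0%N isT; rewrite addn0.
    by move=> k kj; have := Cw k.+1 kj; rewrite addnS.
  by move=> [C0 Cw] [_|k kj]; rewrite ?addn0// addnS; exact: Cw.
rewrite (IH n.+1 B' (fun k => C k.+1))// cylS integral_mkcondr.
(* Setting the integrand to 0 off [C 0] brings the domain back to the cylinder up to time [n], where
   the one-step property applies. *)
pose f := stay P (fun k => C k.+1) j \_ (C 0%N).
transitivity (\int[law]_(w in cylinder n B) f (Zc n.+1 w)).
  by apply: eq_integral => w _; rewrite /f /patch; congr (if _ then _ else _).
rewrite markov_integral//; last 2 first.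
- by move=> z; apply: erestrict_ge0 => ? _; exact: stay_ge0.
- apply/(measurable_restrictT _ (mC 0%N)); apply: measurable_funTS.
  exact: measurable_stay.
by apply: eq_integral => w _; rewrite [RHS]integral_mkcond.
Qed.

(** Limit of [markov_stay] as [j] grows: continuity from above on the left, dominated convergence
    with bound 1 on the right. *)
Lemma markov_stay_forever n B C : (forall k, measurable (B k)) ->
  (forall k, measurable (C k)) ->
  law (cylinder n B `&` [set w | forall k, C k (Zc (n.+1 + k) w)]) =
  \int[law]_(w in cylinder n B) stay_forever P C (Zc n w).
Proof.
move=> mB mC.
pose F j := cylinder n B `&`
  [set w | forall k, (k < j)%N -> C k (Zc (n.+1 + k) w)].
have mF j : measurable (F j).
  apply: measurableI; first exact: measurable_cylinder.
  rewrite (_ : mkset _ = \bigcap_(k in [set k | (k < j)%N])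
    [set w | C k (Zc (n.+1 + k) w)])//.
  by apply: bigcap_measurableType => k _; exact: measurable_hit.
have -> : cylinder n B `&` [set w | forall k, C k (Zc (n.+1 + k) w)] =
    \bigcap_j F j.
  apply/seteqP; split => [w [cw Cw] j _|w Fw]; first by split.
  have [cw _] := Fw 0%N I; split => // k.
  by have [_ /(_ k (ltnSn k))] := Fw k.+1 I.
have cF : law (F j) @[j --> \oo] --> law (\bigcap_j F j).
  apply: nonincreasing_cvg_mu => //.
  - by apply: (le_lt_trans (probability_le1 law (mF 0%N))); rewrite ltry.
  - exact: bigcapT_measurable.
  - apply/nonincreasing_seqP => j; apply/subsetPset => w [cw Fw]; split => // k kj.
    by apply: Fw; exact: ltnW.
apply: (cvg_unique _ cF) => //.
rewrite (_ : (fun j => law (F j)) =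
  fun j => \int[law]_(w in cylinder n B) stay P C j (Zc n w)); last first.
  by apply/funext => j; rewrite -markov_stay.
apply: (@dominated_cvg _ _ _ _ _ _ _ _ (cst 1)) => //.
- exact: measurable_cylinder.
- move=> j; apply: measurable_funTS.
  exact: measurableT_comp (measurable_stay P j mC) (mZ n).
- by move=> w _; exact: cvg_stay.
- by apply: finite_measure_integrable_cst; exact: measurable_cylinder.
- by move=> j w _; rewrite gee0_abs ?stay_ge0// stay_le1.
Qed.

End markov.

(** * The Euclidean plane: norm, rational balls, Haar measure of balls *)

Section plane.
Variable R : realType.
Implicit Types (u v s t : (R * R)%type) (e r : R).

Lemma enorm_le_sum u : enorm u <= `|u.1| + `|u.2|.
Proof.
have := normr_ge0 u.1; have := normr_ge0 u.2 => h2 h1.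
rewrite -[leRHS]ger0_norm ?addr_ge0// -sqrtr_sqr ler_wsqrtr//.
rewrite -(real_normK (num_real u.1)) -(real_normK (num_real u.2)); nra.
Qed.

Lemma ler_norm_enorm u : `|u.1| <= enorm u /\ `|u.2| <= enorm u.
Proof.
by split; rewrite -sqrtr_sqr ler_wsqrtr// ?lerDl ?lerDr sqr_ge0.
Qed.

Lemma enorm_add u v : enorm (p2add u v) <= enorm u + enorm v.
Proof.
case: u v => [a b] [c d]; rewrite /enorm /=.
set x := a ^+ 2 + b ^+ 2; set y := c ^+ 2 + d ^+ 2.
have x0 : 0 <= x by rewrite addr_ge0 ?sqr_ge0.
have y0 : 0 <= y by rewrite addr_ge0 ?sqr_ge0.
have sx := sqrtr_ge0 x; have sy := sqrtr_ge0 y.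
rewrite -[leRHS]ger0_norm ?addr_ge0// -sqrtr_sqr ler_wsqrtr//.
rewrite (sqrrD (Num.sqrt x)) !sqr_sqrtr// -sqrtrM//.
(* Cauchy-Schwarz, from [(a d - b c)^2 >= 0]. *)
have : a * c + b * d <= Num.sqrt (x * y).
  apply: le_trans (ler_norm _) _; rewrite -sqrtr_sqr ler_wsqrtr//.
  have := sqr_ge0 (a * d - b * c); rewrite /x /y; nra.
by rewrite /x /y; nra.
Qed.

Lemma enorm_opp u : enorm (- u.1, - u.2) = enorm u.
Proof. by rewrite /enorm /= !sqrrN. Qed.

Lemma enorm_subC u v : enorm (p2sub u v) = enorm (p2sub v u).
Proof. by rewrite -enorm_opp /p2sub /= !opprB. Qed.

Lemma enorm_triangle u v t :
  enorm (p2sub u t) <= enorm (p2sub u v) + enorm (p2sub v t).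
Proof.
have <- : p2add (p2sub u v) (p2sub v t) = p2sub u t.
  by rewrite /p2add /p2sub /=; congr pair; ring.
exact: enorm_add.
Qed.

Lemma eball_subset s t e r : enorm (p2sub s t) + e <= r ->
  eball s e `<=` eball t r.
Proof.
by move=> h u; rewrite /eball /= => us; have := enorm_triangle u s t; lra.
Qed.

Lemma measurable_eball s e : measurable (eball s e).
Proof.
have -> : eball s e =
    [set t | enorm (p2sub t s) \in `]-oo, e[%R]
  by apply/seteqP; split => t; rewrite /eball /= in_itv.
have mf : measurable_fun [set: (R * R)%type] (fun t => enorm (p2sub t s)).
  apply: (measurableT_comp (f := @Num.sqrt R)
    (g := fun t : R * R => (p2sub t s).1 ^+ 2 + (p2sub t s).2 ^+ 2)).
    by apply: continuous_measurable_fun => x; exact: sqrt_continuous.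
  by apply: measurable_funD; apply: measurable_funX; apply: measurable_funB.
rewrite -[X in measurable X]setTI.
apply: (mf measurableT [set x | x \in `]-oo, e[%R]); exact: measurable_itv.
Qed.

Lemma measurable_p2add s : measurable_fun [set: (R * R)%type] (fun u => p2add u s).
Proof.
by apply: measurable_fun_pair => /=; apply: measurable_funD.
Qed.

(** An enumeration of the rational points by [nat], so that unions over rational balls are
    countable. Codes that decode to nothing give (0, 0), which is itself rational. *)
Definition ratpoint (k : nat) : (R * R)%type :=
  if unpickle k : option (rat * rat) is Some p then (ratr p.1, ratr p.2) else (0, 0).

Lemma dense_ratpoint u e : 0 < e -> exists k, enorm (p2sub u (ratpoint k)) < e.
Proof.
move=> e0; have approx (x : R) : exists q : rat, `|x - ratr q| < e / 2.
  have [|q] := @rat_in_itvoo R (x - e / 2) (x + e / 2); first by lra.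
  by rewrite in_itv /= => /andP[h1 h2]; exists q; rewrite ltr_norml; lra.
have [p hp] := approx u.1; have [q hq] := approx u.2.
exists (pickle (p, q)); rewrite /ratpoint pickleK /=.
by apply: le_lt_trans (enorm_le_sum _) _; rewrite /=; lra.
Qed.

(** Links the product topology to the product sigma-algebra: the open complement is the union of the
    Euclidean balls with rational centre and radius [n.+1%:R^-1] that it contains. *)
Lemma measurable_closed2 (A : set (R * R)) :
  closed (A : set (R^o * R^o)%type) -> measurable A.
Proof.
move=> cA; rewrite -(setCK A); apply: measurableC.
rewrite (_ : ~` A = \bigcup_n \bigcup_(k in
    [set k | eball (ratpoint k) n.+1%:R^-1 `<=` ~` A])
    eball (ratpoint k) n.+1%:R^-1).
  apply: bigcupT_measurable => n; apply: bigcup_measurable => k _.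
  exact: measurable_eball.
apply/seteqP; split => [u nAu|u [n _ [k /= + uk]]]; last exact.
have oA : open (~` A : set (R^o * R^o)%type) by exact: closed_openC.
have /nbhs_ballP[e /= e0 ballA] : nbhs (u : (R^o * R^o)%type) (~` A).
  exact: (open_nbhs_nbhs (conj oA nAu)).
have [n hn] : exists n, n.+1%:R^-1 < e / 2 :> R.
  have e20 : 0 < e / 2 by lra.
  have [n _ hn] := near_infty_natSinv_lt (PosNum e20).
  by exists n; exact: (hn n (leqnn n)).
have n0 : 0 < n.+1%:R^-1 :> R by rewrite invr_gt0.
exists n => //; have [k uk] := dense_ratpoint u n0.
exists k; last by rewrite /eball /= .
move=> t tk; apply: ballA.
have ut : enorm (p2sub u t) < e.
  apply: le_lt_trans (enorm_triangle u (ratpoint k) t) _.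
  rewrite (enorm_subC _ t); move: tk; rewrite /eball /=.
  by move: n.+1%:R^-1 hn uk => r; lra.
(* Balls of the product topology are squares, so each coordinate is compared separately. *)
have [h1 h2] := ler_norm_enorm (p2sub u t).
by split; rewrite /ball /=; [apply: le_lt_trans h1 _|apply: le_lt_trans h2 _].
Qed.

(** If one such ball were null, invariance would make every ball of radius [e] centred in the group
    null. The rational balls of radius [e / 2] cover the plane; one that meets the group lies in
    such a null ball, and one that misses it lies in the null complement. So the whole plane would
    be null. *)
Lemma haar_on_eball_gt0 (Sg : set (R * R))
    (m : {measure set (R * R)%type -> \bar R}) s e :
  closed_subgroup2 Sg -> haar_on Sg m -> Sg s -> 0 < e ->
  (0 < m (eball s e))%E.
Proof.
move=> [cSg Sg0 SgB _] [mC mT _ minv] Ss e0.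
have mSg := measurable_closed2 cSg.
rewrite lt_neqAle measure_ge0 andbT; apply/eqP => /esym ms0.
have mball t : Sg t -> m (eball t e) = 0%E.
  move=> St; have Sts : Sg (p2sub t s) by exact: SgB.
  rewrite -ms0 -(minv _ _ Sts (measurable_eball s e)); congr (m _).
  apply/seteqP; split => u; rewrite /eball /= /p2sub /= !opprB => h.
    by rewrite (_ : u.1 + (s.1 - t.1) - s.1 = u.1 - t.1)
      1?(_ : u.2 + (s.2 - t.2) - s.2 = u.2 - t.2)//; ring.
  by move: h; rewrite (_ : u.1 + (s.1 - t.1) - s.1 = u.1 - t.1)
      1?(_ : u.2 + (s.2 - t.2) - s.2 = u.2 - t.2)//; ring.
have : m.-negligible (\bigcup_k eball (ratpoint k) (e / 2)).
  apply: negligible_bigcup => k.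
  exists (eball (ratpoint k) (e / 2)); split => //; first exact: measurable_eball.
  apply/eqP; rewrite -measure_le0.
  have [[t [St tk]]|nS] := pselect (exists t, Sg t /\ eball (ratpoint k) (e / 2) t).
    rewrite -(mball _ St); apply: le_measure; rewrite ?inE//.
    - exact: measurable_eball.
    - exact: measurable_eball.
    - apply: eball_subset; rewrite enorm_subC.
      by move: tk; rewrite /eball /=; lra.
  rewrite -mC; apply: le_measure; rewrite ?inE//.
  - exact: measurable_eball.
  - exact: measurableC.
  - by move=> t tk St; apply: nS; exists t.
move=> /negligibleP mcov.
have e20 : 0 < e / 2 by lra.
have covT : \bigcup_k eball (ratpoint k) (e / 2) = setT.
  apply/seteqP; split => // u _.
  by have [k uk] := dense_ratpoint u e20; exists k.
by move: mT; rewrite -covT mcov ?ltxx// covT.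
Qed.

End plane.

(** * Comparison with a divergent series *)

Lemma ratio_limit_le0 (R : realType) (a : nat -> R) (b : nat -> \bar R)
    (c : \bar R) (K : R) :
  (forall n, (0 < n)%N -> 0 < a n) ->
  (\sum_(1 <= n <oo) (a n)%:E)%E = +oo%E ->
  (forall n, 0 <= b n)%E ->
  (forall M, \sum_(1 <= n < M) b n <= K%:E)%E ->
  (fun n => b n * ((a n)^-1)%:E)%E @ \oo --> c ->
  (c <= 0)%E.
Proof.
move=> a0 aoo b0 bK bac; rewrite leNgt; apply/negP => c0.
(* A real [r] strictly between 0 and the possibly infinite [c] gives [b n >= r * a n] from some
   index on; the bound [K] would then bound the partial sums of [a]. *)
have [r r0 rc] : exists2 r : R, 0 < r & (r%:E < c)%E.
  case: c c0 {bac} => [c| |//]; last by move=> _; exists 1 => //; rewrite ltry.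
  by rewrite lte_fin => c0; exists (c / 2); rewrite ?lte_fin; lra.
have [n0 _ hn0] : \forall n \near \oo, (r%:E < b n * ((a n)^-1)%:E)%E.
  apply: (bac [set x | r%:E < x]%E).
  by apply: open_nbhs_nbhs; split => //; exact: open_ereal_gt_ereal.
have ba n : (n0 < n)%N -> ((r * a n)%:E <= b n)%E.
  move=> n0n; have n1 : (0 < n)%N by exact: leq_ltn_trans n0n.
  by have := hn0 n (ltnW n0n) => /= /ltW; rewrite lee_pdivlMr ?a0// EFinM.
have aK M : (n0 < M)%N -> (\sum_(1 <= n < M) (a n)%:E <=
    (\sum_(1 <= n < n0.+1) a n + K / r)%:E)%E.
  move=> n0M; rewrite sumEFin lee_fin (@big_cat_nat _ _ _ n0.+1)//= lerD2l.
  rewrite ler_pdivlMr// mulrC mulr_sumr -lee_fin -sumEFin.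
  apply: le_trans (bK M); rewrite [leRHS](@big_cat_nat _ _ _ n0.+1)//=.
  apply: le_trans (_ : _ <= \sum_(n0.+1 <= n < M) b n)%E _.
    rewrite big_nat_cond [leRHS]big_nat_cond; apply: lee_sum.
    by move=> n /andP[/andP[h _] _]; exact: ba.
  by rewrite leeDr// sume_ge0.
have : (\sum_(1 <= n <oo) (a n)%:E <=
    (\sum_(1 <= n < n0.+1) a n + K / r)%:E)%E.
  apply: lime_le.
    by apply: is_cvg_nneseries => n n1 _; rewrite lee_fin; exact/ltW/a0.
  by exists n0.+1 => // M /= n0M; exact: aK.
by rewrite aoo leNgt ltry.
Qed.

Lemma probability_setIl1 d (T : measurableType d) (R : realType)
    (p : probability T R) (A B : set T) :
  measurable A -> measurable B -> p A = 1%E -> p (A `&` B) = p B.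
Proof.
move=> mA mB pA; have -> : p B = (p (B `\` A) + p (A `&` B))%E.
  by rewrite setIC; exact: measureDI.
rewrite (_ : p (B `\` A) = 0%E) ?add0e//.
apply/eqP; rewrite -measure_le0 -(subee (x := 1%E))// -[in X in (_ - X)%E]pA.
rewrite -probability_setC//; apply: le_measure; rewrite ?inE//.
- exact: measurableD.
- exact: measurableC.
Qed.

(** * The Markov random walk: translations, initial law, stationarity *)

Section walk.
Local Open Scope ereal_scope.
Context d (X : measurableType d) (R : realType).
Context dO (Om : measurableType dO).
Variable P : R.-pker (X * (R * R))%type ~> (X * (R * R))%type.
Variables (Xc : nat -> Om -> X) (Sc : nat -> Om -> (R * R)%type).
Variable law : probability X R -> probability Om R.
Hypothesis walk : is_MRW P Xc Sc law.

Let Z := (X * (R * R))%type.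
Let Zc n w : Z := (Xc n w, Sc n w).

Definition translate (s : R * R) (z : X * (R * R)) : X * (R * R) :=
  (z.1, p2add z.2 s).

Lemma measurable_translate s : measurable_fun setT (translate s).
Proof.
apply: measurable_fun_pair => //=.
exact: measurableT_comp (measurable_p2add s) (@measurable_snd _ _ _ _).
Qed.

(** [is_MRW] gives this on rectangles; uniqueness of measures extends it to all measurable sets. *)
Lemma kernel_translate s z A : measurable A ->
  P (translate s z) A = P z (translate s @^-1` A).
Proof.
have [_ Ptr _] := walk.
move: A; apply: (@eq_measure_rectangles _ _ _ _ _ _
  (measure_function_pushforward__canonical__measure_function_Measure
    (P z) (measurable_translate s))).
  by rewrite (prob_kernel (s := P)) ltry.
move=> A B mA mB; case: z => x t /=; rewrite /translate /= Ptr//.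
rewrite /pushforward (_ : _ @^-1` _ = A `*` [set u | B (p2add u s)])//.
rewrite [RHS]Ptr//; last first.
  rewrite -[X in measurable X]setTI; exact: measurable_p2add.
congr (P _ (_ `*` _)); apply/seteqP; split => u /=;
  by rewrite /p2add /= addrA addrA.
Qed.

Lemma stay_forever_translate C x s : (forall k, measurable (C k)) ->
  stay_forever P C (x, s) =
  stay_forever P (fun k => translate s @^-1` C k) (x, (0, 0)%R).
Proof.
move=> mC; transitivity (stay_forever P C (translate s (x, (0, 0)%R))).
  by rewrite /translate /= /p2add /= !add0r -surjective_pairing.
apply: stay_forever_equivariant => //; first exact: measurable_translate.
by move=> *; exact: kernel_translate.
Qed.

Let mXc n : measurable_fun setT (Xc n).
Proof. by have [/(_ n)[]] := walk. Qed.

Let mSc n : measurable_fun setT (Sc n).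
Proof. by have [/(_ n)[]] := walk. Qed.

Let mZc n : measurable_fun setT (Zc n).
Proof. exact: measurable_fun_pair. Qed.

Lemma law_hit_stay (mu : probability X R) n A C :
  measurable A -> (forall k, measurable (C k)) ->
  law mu ([set w | A (Zc n w)] `&` [set w | forall k, C k (Zc (n.+1 + k) w)]) =
  \int[law mu]_(w in [set w | A (Zc n w)]) stay_forever P C (Zc n w).
Proof.
move=> mA mC; have [_ _ /(_ mu)[_ mk]] := walk.
(* Only time [n] is constrained, so the cylinder is the event of a visit to [A] at time [n]. *)
pose B k := if k == n then A else setT.
have mB k : measurable (B k) by rewrite /B; case: ifP.
have <- : cylinder Zc n B = [set w | A (Zc n w)].
  apply/seteqP; split => w /=.
    by move=> /(_ n (leqnn n)); rewrite /B eqxx.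
  by move=> Aw k _; rewrite /B; case: eqP => // ->.
by apply: markov_stay_forever => //; exact: mk.
Qed.

(** [is_MRW] makes [Sc 0] vanish almost surely rather than pointwise, so time 0 is handled on this
    event. *)
Let origin : set Z := [set z | z.2 = (0, 0)%R].

Let morigin : measurable origin.
Proof.
rewrite (_ : origin = setT `*` ([set 0%R] `*` [set 0%R])).
  by apply: measurableX => //; apply: measurableX; exact: measurable_set1.
by apply/seteqP; split => [[x [a b]] /= [-> ->]|[x [a b]] /= [_ [-> ->]]].
Qed.

Let measurable_origin : measurable [set w | origin (Zc 0 w)].
Proof. by rewrite -[X in measurable X]setTI; exact: mZc. Qed.

Let law_origin mu : law mu [set w | origin (Zc 0 w)] = 1.
Proof.
have [_ _ /(_ mu)[init _]] := walk.
have := init setT measurableT; rewrite probability_setT => <-.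
by congr (law mu _); apply/seteqP; split => w //= [].
Qed.

Let law_origin_initial mu A : measurable A ->
  law mu ([set w | origin (Zc 0 w)] `&` [set w | A (Xc 0 w)]) = mu A.
Proof.
move=> mA; have [_ _ /(_ mu)[init _]] := walk.
by rewrite -init//; congr (law mu _); apply/seteqP; split => w /= [].
Qed.

Lemma measurable_stay_event C : (forall k, measurable (C k)) ->
  measurable [set w | forall k, C k (Zc k.+1 w)].
Proof.
move=> mC; rewrite (_ : mkset _ = \bigcap_k (Zc k.+1 @^-1` C k)); last first.
  by apply/seteqP; split => [w h k _|w h k]; [exact: h|exact: (h k I)].
apply: bigcapT_measurable => k.
by rewrite -[X in measurable X]setTI; exact: mZc.
Qed.

(** The Markov property at time 0, on the almost sure event [origin], where [Xc 0] has law [mu]. *)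
Lemma law_stay (mu : probability X R) C : (forall k, measurable (C k)) ->
  law mu [set w | forall k, C k (Zc k.+1 w)] =
  \int[mu]_x stay_forever P C (x, (0, 0)%R).
Proof.
move=> mC.
transitivity (law mu ([set w | origin (Zc 0 w)] `&`
    [set w | forall k, C k (Zc (1 + k) w)])).
  by rewrite probability_setIl1//; exact: measurable_stay_event.
rewrite law_hit_stay//.
have mH : measurable_fun setT (fun x => stay_forever P C (x, (0, 0)%R)).
  exact: measurableT_comp (measurable_stay_forever P mC) (pair2_measurable _).
transitivity (\int[law mu]_(w in [set w | origin (Zc 0 w)])
    stay_forever P C (Xc 0 w, (0, 0)%R)).
  by apply: eq_integral => w; rewrite inE /origin /Zc /= => ->.
apply: (ge0_integral_same_law (Y := Xc 0)
  (f := fun x => stay_forever P C (x, (0, 0)%R))) => //.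
- by move=> A mA; exact: law_origin_initial.
- by move=> x; exact: stay_forever_ge0.
Qed.

Lemma law_stationary (pi : probability X R) n A :
  (forall B, measurable B -> \int[pi]_x Qker P x B = pi B) -> measurable A ->
  law pi [set w | A (Xc n w)] = pi A.
Proof.
move=> inv; have [_ Ptr /(_ pi)[_ mk]] := walk.
elim: n A => [|n IH] A mA.
  have mA0 : measurable [set w | A (Xc 0 w)].
    by rewrite -[X in measurable X]setTI; exact: mXc.
  by rewrite -law_origin_initial// probability_setIl1.
have mQ : measurable_fun setT (fun x => Qker P x A).
  rewrite /Qker; apply: (measurableT_comp (f := fun z => P z (A `*` setT))
    (g := fun x => (x, (0, 0)%R))); last exact: pair2_measurable.
  by apply: measurable_kernel; exact: measurableX.
transitivity (\int[law pi]_w Qker P (Xc n w) A).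
  have := mk n (fun=> setT) (A `*` setT) (fun=> measurableT)
    (measurableX mA measurableT).
  have -> : [set w | forall k, (k <= n)%N -> [set: Z] (Xc k w, Sc k w)] = setT.
    by apply/seteqP; split.
  rewrite setTI => mkT.
  transitivity (law pi [set w | (A `*` setT) (Xc n.+1 w, Sc n.+1 w)]).
    by congr (law pi _); apply/seteqP; split => w //= [].
  (* The target leaves the position free, so translation invariance lets the current position be
     replaced by 0, which turns [P] into [Qker]. *)
  rewrite mkT; apply: eq_integral => w _; rewrite Ptr//.
rewrite (@ge0_integral_same_law _ _ _ _ _ _ pi setT (Xc n)
  (fun x => Qker P x A))//; last first.
  by move=> B mB; rewrite setTI; exact: IH.
exact: inv.
Qed.

End walk.

(** All indices satisfying [p] lie between the least one, [m], and [m + N]. *)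
Lemma card_overlap_le (N M : nat) (p : pred nat) :
  (forall i j, p i -> p j -> (i <= j)%N -> (j <= i + N)%N) ->
  (\sum_(1 <= n < M) p n <= N.+1)%N.
Proof.
move=> pN.
have [[n0 pn0]|np] := pselect (exists n, p n); last first.
  rewrite big1_seq// => n _; case: (boolP (p n)) => // pn; exfalso.
  by apply: np; exists n.
case: (ex_minnP (ex_intro _ n0 pn0)) => m pm mmin.
rewrite -big_mkcond/= sum1_count -size_filter.
apply: (@leq_trans (size (iota m N.+1))); last by rewrite size_iota.
apply: uniq_leq_size; first by rewrite filter_uniq// iota_uniq.
move=> n; rewrite mem_filter mem_iota addnS ltnS => /andP[pn _].
by rewrite mmin//= pN// mmin.
Qed.

(** * Visiting one ball, then avoiding another *)

Section recurrence.
Local Open Scope ereal_scope.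
Context d (X : measurableType d) (R : realType).
Context dO (Om : measurableType dO).
Variable P : R.-pker (X * (R * R))%type ~> (X * (R * R))%type.
Variables (Xc : nat -> Om -> X) (Sc : nat -> Om -> (R * R)%type).
Variable law : probability X R -> probability Om R.
Hypothesis walk : is_MRW P Xc Sc law.

(** Index [k] of a constraint concerns time [k + 1], so [stay_forever P (avoid N D)] is the
    probability of staying out of [D] from time [N + 1] on. *)
Definition avoid (N : nat) (D : set (R * R)) (k : nat) : set (X * (R * R)) :=
  [set z | (N <= k)%N -> ~ D z.2].

Lemma measurable_avoid N D k : measurable D -> measurable (avoid N D k).
Proof.
move=> mD; rewrite /avoid; have [Nk|kN] := leqP N k.
  rewrite (_ : mkset _ = setT `*` ~` D).
    by apply: measurableX => //; exact: measurableC.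
  by apply/seteqP; split => [z h|z [_ h] _]; [split => //; exact: h|exact: h].
rewrite (_ : mkset _ = setT)//.
by apply/seteqP; split => // z _ /= h; rewrite leqNgt kN in h.
Qed.
Hint Resolve measurable_avoid measurable_eball : core.

Definition avoid_prob N s e (x : X) : \bar R :=
  stay_forever P (avoid N (eball s e)) (x, (0, 0)%R).

Lemma measurable_avoid_prob N s e : measurable_fun setT (avoid_prob N s e).
Proof.
apply: (measurableT_comp (f := stay_forever P (avoid N (eball s e)))
  (g := fun x => (x, (0, 0)%R))); last exact: pair2_measurable.
by apply: measurable_stay_forever => k; exact: measurable_avoid.
Qed.

Lemma avoid_prob_fin N s e x : avoid_prob N s e x \is a fin_num.
Proof.
rewrite ge0_fin_numE; last exact: stay_forever_ge0.
by apply: le_lt_trans (stay_forever_le1 _ _ _) _; rewrite ltry.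
Qed.

Lemma avoid_prob_subset N s t e r x : eball s e `<=` eball t r ->
  avoid_prob N t r x <= avoid_prob N s e x.
Proof.
move=> st; apply: stay_forever_subset; first by move=> k; exact: measurable_avoid.
  by move=> k; exact: measurable_avoid.
by move=> k z h Nk /st; exact: h.
Qed.

(** A start at [u] is a start at 0 with the target shifted by [-u], and a smaller target is easier
    to avoid. This upper bound serves [rec_set_of_hitting], the reverse one below serves
    [visit_then_avoid_ge]. *)
Lemma avoid_prob_translate N s e x u t r :
  eball s e `<=` [set v | eball t r (p2add v u)] ->
  stay_forever P (avoid N (eball t r)) (x, u) <= avoid_prob N s e x.
Proof.
move=> st; rewrite (stay_forever_translate walk); last first.
  by move=> k; exact: measurable_avoid.
apply: stay_forever_subset.
- move=> k; rewrite -[X in measurable X]setTI.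
  by apply: measurable_translate => //; exact: measurable_avoid.
- by move=> k; exact: measurable_avoid.
- by move=> k z h Nk /st; exact: h.
Qed.

Lemma avoid_prob_translate_ge N s e x u t r :
  [set v | eball t r (p2add v u)] `<=` eball s e ->
  avoid_prob N s e x <= stay_forever P (avoid N (eball t r)) (x, u).
Proof.
move=> st; rewrite (stay_forever_translate walk); last first.
  by move=> k; exact: measurable_avoid.
apply: stay_forever_subset.
- by move=> k; exact: measurable_avoid.
- move=> k; rewrite -[X in measurable X]setTI.
  by apply: measurable_translate => //; exact: measurable_avoid.
- by move=> k z h Nk /st; exact: h.
Qed.

Let mXc n : measurable_fun setT (Xc n).
Proof. by have [/(_ n)[]] := walk. Qed.

Let mSc n : measurable_fun setT (Sc n).
Proof. by have [/(_ n)[]] := walk. Qed.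

Definition visit_then_avoid n N t dl u r : set Om :=
  [set w | eball t dl (Sc n w)] `&`
  [set w | forall k, (N <= k)%N -> ~ eball u r (Sc (n.+1 + k) w)].

Lemma measurable_visit n t r : measurable [set w | eball t r (Sc n w)].
Proof.
by rewrite -[X in measurable X]setTI; apply: mSc => //; exact: measurable_eball.
Qed.

Lemma measurable_avoid_from n N u r :
  measurable [set w | forall k, (N <= k)%N -> ~ eball u r (Sc (n + k) w)].
Proof.
rewrite (_ : mkset _ = \bigcap_(k in [set k | (N <= k)%N])
  ~` [set w | eball u r (Sc (n + k) w)])//.
apply: bigcap_measurableType => k _.
by apply: measurableC; exact: measurable_visit.
Qed.

Lemma measurable_visit_then_avoid n N t dl u r :
  measurable (visit_then_avoid n N t dl u r).
Proof.
by apply: measurableI; [exact: measurable_visit|exact: measurable_avoid_from].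
Qed.

(** The Markov property at time [n] writes the right-hand side as an integral over the visit. Since
    [S_n] is within [dl] of [t] and [r + dl <= e], the ball [B(s, e)] shifted by [S_n] contains
    [B(s + t, r)], so avoiding the former implies avoiding the latter. The real-valued [fine]
    matches the test functions of (LL0). *)
Lemma visit_then_avoid_ge (mu : probability X R) n N s e t dl r :
  (r + dl <= e)%R ->
  \int[law mu]_w
    (fine (avoid_prob N s e (Xc n w)) * \1_(eball t dl) (Sc n w))%:E <=
  law mu (visit_then_avoid n N t dl (p2add s t) r).
Proof.
move=> rde.
pose A : set (X * (R * R)) := setT `*` eball t dl.
have AE : [set w | A (Xc n w, Sc n w)] = [set w | eball t dl (Sc n w)].
  by apply/seteqP; split => w //= [].
have -> : visit_then_avoid n N t dl (p2add s t) r =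
    [set w | A (Xc n w, Sc n w)] `&`
    [set w | forall k, avoid N (eball (p2add s t) r) k
      (Xc (n.+1 + k) w, Sc (n.+1 + k) w)] by rewrite AE.
rewrite (law_hit_stay walk)//; last 2 first.
- exact: measurableX.
- by move=> k; exact: measurable_avoid.
rewrite AE [leRHS]integral_mkcond.
apply: ge0_le_integral => //.
- move=> w _; rewrite lee_fin mulr_ge0// fine_ge0//; exact: stay_forever_ge0.
- apply/measurable_EFinP; apply: measurable_funM.
    apply: (measurableT_comp (f := fine \o avoid_prob N s e)) => //.
    by apply: measurableT_comp => //; exact: measurable_avoid_prob.
  apply: (measurableT_comp (f := (\1_(eball t dl) : (R * R)%type -> R))
    (g := Sc n)) => //.
  by apply: measurable_indic; exact: measurable_eball.
- apply/(measurable_restrictT _ (measurable_visit n t dl)).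
  apply: measurable_funTS.
  apply: (measurableT_comp (f := stay_forever P _)
    (g := fun w => (Xc n w, Sc n w))); last exact: measurable_fun_pair.
  by apply: measurable_stay_forever => k; exact: measurable_avoid.
- move=> w _; rewrite patchE indicE.
  have [Bw|nBw] := boolP (Sc n w \in eball t dl); last first.
    rewrite mulr0; case: ifP => // _; exact: stay_forever_ge0.
  have -> : (w \in [set w | eball t dl (Sc n w)]) by exact: Bw.
  rewrite mulr1 fineK ?avoid_prob_fin//; apply: avoid_prob_translate_ge.
  move=> v /=; move: Bw; rewrite inE /eball /= => h1 h2.
  have -> : p2sub v s = p2add (p2sub (p2add v (Sc n w)) (p2add s t))
      (p2sub t (Sc n w)).
    by rewrite /p2sub /p2add /=; congr pair; ring.
  apply: le_lt_trans (enorm_add _ _) _; rewrite (enorm_subC t); lra.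
Qed.
End recurrence.

(** * Consequences of the local limit hypothesis *)

Section locallimit.
Local Open Scope ereal_scope.
Context d (X : measurableType d) (R : realType).
Context dO (Om : measurableType dO).
Variable P : R.-pker (X * (R * R))%type ~> (X * (R * R))%type.
Variables (Xc : nat -> Om -> X) (Sc : nat -> Om -> (R * R)%type).
Variable law : probability X R -> probability Om R.
Hypothesis walk : is_MRW P Xc Sc law.

(** By [law_stay], the probability under [law mu] is the [mu]-average of the probabilities under the
    point starts. *)
Lemma law_stay_null (mu : probability X R) C : (forall k, measurable (C k)) ->
  (forall x, law (pdirac R x)
     [set w | forall k, C k (Xc k.+1 w, Sc k.+1 w)] = 0) ->
  law mu [set w | forall k, C k (Xc k.+1 w, Sc k.+1 w)] = 0.
Proof.
move=> mC C0; rewrite (law_stay walk)// integral0_eq// => x _.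
have := C0 x; rewrite (law_stay walk)// integral_dirac ?diracT ?mul1e//.
apply: (measurableT_comp (f := stay_forever P C) (g := fun x => (x, (0, 0)%R))).
  exact: measurable_stay_forever.
exact: pair2_measurable.
Qed.

Variables (pi : probability X R) (Sg : set (R * R)).
Variable m : {measure set (R * R)%type -> \bar R}.
Hypothesis subSg : closed_subgroup2 Sg.
Hypothesis haarSg : haar_on Sg m.
Variables (epsS : R) (a : nat -> R).
Hypothesis epsS0 : (0 < epsS)%R.
Hypothesis a0 : forall n, (0 < n)%N -> (0 < a n)%R.
Hypothesis aoo : \sum_(1 <= n <oo) (a n)%:E = +oo.
Hypothesis LL0 : forall (s : R * R) (eps : R), Sg s ->
  (0 < eps)%R -> (eps < epsS)%R ->
  forall f : X -> R, measurable_fun setT f -> (forall x, (0 <= f x)%R) ->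
  (exists M : R, forall x, (f x <= M)%R) ->
  ((fun n => (\int[law pi]_w (f (Xc n w) * \1_(eball s eps) (Sc n w))%:E)
              * ((a n)^-1)%:E) @ \oo
   --> ((\int[pi]_x (f x)%:E) * m (eball s eps))).

(** (LL0) is applied with [f] the avoidance probability. By [visit_then_avoid_ge] its integrals have
    partial sums at most [K], so [ratio_limit_le0] makes the limit nonpositive; the ball around [t]
    has positive Haar measure, so the other factor vanishes. *)
Lemma avoid_prob_null N s t e dl r (K : R) :
  Sg t -> (0 < dl)%R -> (dl < epsS)%R -> (r + dl <= e)%R ->
  (forall M, \sum_(1 <= n < M)
     law pi (visit_then_avoid Sc n N t dl (p2add s t) r) <= K%:E) ->
  \int[pi]_x avoid_prob P N s e x = 0.
Proof.
move=> St dl0 dlS rde bK.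
pose f x := fine (avoid_prob P N s e x).
have f0 x : (0 <= f x)%R by rewrite fine_ge0//; exact: stay_forever_ge0.
have fE : \int[pi]_x (f x)%:E = \int[pi]_x avoid_prob P N s e x.
  by apply: eq_integral => x _; rewrite fineK// avoid_prob_fin.
have mf : measurable_fun setT f.
  by apply: measurableT_comp => //; exact: measurable_avoid_prob.
have fM : exists M, forall x, (f x <= M)%R.
  exists 1%R => x; rewrite -lee_fin fineK ?avoid_prob_fin//.
  exact: stay_forever_le1.
have c0 := ratio_limit_le0 a0 aoo _ _ (LL0 St dl0 dlS mf f0 fM).
have : \int[pi]_x (f x)%:E * m (eball t dl) <= 0.
  apply: (c0 K).
  - move=> n; apply: integral_ge0 => w _; rewrite lee_fin mulr_ge0//.
  - move=> M; apply: le_trans (bK M); apply: lee_sum => n _.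
    exact: (visit_then_avoid_ge walk).
rewrite pmule_lle0; last exact: (haar_on_eball_gt0 subSg haarSg).
rewrite fE => h; apply/eqP; rewrite eq_le h /=.
by apply: integral_ge0 => x _; exact: stay_forever_ge0.
Qed.

Let small e : (0 < e)%R ->
  exists dl, [/\ (0 < dl)%R, (dl < epsS)%R & (dl + dl <= e)%R].
Proof.
move=> e0; have eS0 := epsS0; have [h|h] := leP e epsS.
  by exists (e / 2)%R; split; lra.
by exists (epsS / 2)%R; split; lra.
Qed.

Lemma law_avoid (mu : probability X R) N s e :
  law mu [set w | forall k, (N <= k)%N -> ~ eball s e (Sc k.+1 w)] =
  \int[mu]_x avoid_prob P N s e x.
Proof.
rewrite -(law_stay walk)// => k; apply: measurable_avoid.
exact: measurable_eball.
Qed.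

(** Here the visited and the avoided balls coincide: if the events of times [i <= j] both occur, the
    visit at time [j] forces [j <= i + N]. Each path thus lies in at most [N + 1] events, which is
    the bound [K]. *)
Lemma return_origin N e : (0 < e)%R ->
  \int[pi]_x avoid_prob P N (0, 0)%R e x = 0.
Proof.
move=> e0; have [dl [dl0 dlS dle]] := small e0.
have [_ Sg0 _ _] := subSg.
apply: (@avoid_prob_null _ _ (0, 0)%R _ dl dl N.+1%:R) => // M.
rewrite (_ : p2add _ _ = (0, 0)%R); last by rewrite /p2add /= addr0.
set E := fun n => visit_then_avoid Sc n N (0, 0)%R dl (0, 0)%R dl.
have mE n : measurable (E n) by exact: (measurable_visit_then_avoid walk).
(* The sum of the probabilities is the expected number of events that occur. *)
rewrite (eq_bigr (fun n => \int[law pi]_w (\1_(E n) w)%:E)); last first.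
  by move=> n _; rewrite integral_indic// setIT.
rewrite -ge0_integral_sum//; last first.
  by move=> n; apply/measurable_EFinP; exact: measurable_indic.
rewrite -[leRHS]mule1 -(probability_setT (law pi)) -integral_cst//.
apply: ge0_le_integral => //.
- by move=> w _; apply: sume_ge0 => n _; rewrite lee_fin.
- apply: emeasurable_sum => n; apply/measurable_EFinP; exact: measurable_indic.
- move=> w _; rewrite sumEFin lee_fin /cst.
  under eq_bigr do rewrite indicE.
  rewrite -natr_sum ler_nat; apply: card_overlap_le => i j.
  rewrite !inE => -[_ iav] [jv _] ij.
  rewrite leqNgt; apply/negP => Nj; apply: (iav (j - i.+1)%N).
    lia.
  by rewrite subnKC//; lia.
Qed.

(** With [t = - s] the avoided ball is centred at the origin, so every term of the sum is null and
    [K = 0] works. *)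
Lemma hit_everywhere s e : Sg s -> (0 < e)%R ->
  \int[pi]_x avoid_prob P 0 s e x = 0.
Proof.
move=> Ss e0; have [dl [dl0 dlS dle]] := small e0.
have [_ Sg0 SgB _] := subSg.
apply: (@avoid_prob_null _ _ (p2sub (0, 0)%R s) _ dl dl 0) => //; first exact: SgB.
move=> M; rewrite big1// => n _.
rewrite (_ : p2add _ _ = (0, 0)%R); last first.
  by rewrite /p2add /p2sub /=; congr pair; ring.
(* The event keeps the walk away from 0 from time [n + 1] on, hence [return_origin] with
   [N := n]. *)
apply/eqP; rewrite -measure_le0 -(return_origin n dl0) -law_avoid.
apply: le_measure; rewrite ?inE.
- exact: (measurable_visit_then_avoid walk).
- rewrite (_ : mkset _ = [set w | forall k, (n <= k)%N ->
    ~ eball (0, 0)%R dl (Sc (1 + k) w)])//.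
  exact: (measurable_avoid_from walk).
- move=> w [_ h] k nk; have := h (k - n)%N isT.
  by rewrite addSn subnKC.
Qed.

End locallimit.

(** * From hitting every ball to the recurrence set *)

Section hitting.
Local Open Scope ereal_scope.
Context d (X : measurableType d) (R : realType).
Context dO (Om : measurableType dO).
Variable P : R.-pker (X * (R * R))%type ~> (X * (R * R))%type.
Variables (Xc : nat -> Om -> X) (Sc : nat -> Om -> (R * R)%type).
Variable law : probability X R -> probability Om R.
Hypothesis walk : is_MRW P Xc Sc law.
Variables (pi : probability X R) (Sg : set (R * R)).
Hypothesis subSg : closed_subgroup2 Sg.
Hypothesis inSg :
  forall x n, law (pdirac R x) [set w | Sg (Sc n w)] = 1.
Hypothesis hit : forall s e, Sg s -> (0 < e)%R ->
  \int[pi]_x avoid_prob P 0 s e x = 0.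

Let mXc n : measurable_fun setT (Xc n).
Proof. by have [/(_ n)[]] := walk. Qed.

Let mSc n : measurable_fun setT (Sc n).
Proof. by have [/(_ n)[]] := walk. Qed.

(** Rational balls make this a countable intersection, hence measurable. Balls that miss the group
    are excluded, as [hit] says nothing about them. *)
Definition hitting_set r : set X := [set x | forall k,
  (exists s, Sg s /\ eball (ratpoint R k) r s) ->
  avoid_prob P 0 (ratpoint R k) r x = 0].

Lemma measurable_hitting_set r : measurable (hitting_set r).
Proof.
rewrite (_ : hitting_set r = \bigcap_(k in [set k | exists s, Sg s /\
  eball (ratpoint R k) r s]) (avoid_prob P 0 (ratpoint R k) r @^-1` [set 0]))//.
apply: bigcap_measurableType => k _; rewrite -[X in measurable X]setTI.
apply: measurable_avoid_prob => //; exact: emeasurable_set1.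
Qed.

(** A rational centre may lie outside the group, but a ball that meets the group at [s] contains a
    smaller ball around [s], to which [hit] applies. *)
Lemma hitting_setC_null r : (0 < r)%R -> pi (~` hitting_set r) = 0.
Proof.
move=> r0; apply/negligibleP.
  exact: measurableC (measurable_hitting_set r).
pose bad k := [set x | (exists s, Sg s /\ eball (ratpoint R k) r s) /\
  avoid_prob P 0 (ratpoint R k) r x != 0].
apply: (negligibleS (A := (\bigcup_k bad k))).
  move=> x /existsNP[k /not_implyP[gk /eqP nk]]; exists k => //.
apply: negligible_bigcup => k.
have [[s [Ss sk]]|nS] := pselect (exists s, Sg s /\ eball (ratpoint R k) r s);
  last by rewrite (_ : bad k = set0) ?seteqP; [exact: negligible_set0|split => // x []].
have s0 : (0 < r - enorm (p2sub s (ratpoint R k)))%R.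
  by move: sk; rewrite /eball /= subr_gt0.
have f0 : \int[pi]_x `|avoid_prob P 0 (ratpoint R k) r x| = 0.
  apply/eqP; rewrite eq_le integral_ge0// andbT -(hit Ss s0).
  apply: ge0_le_integral => //.
  - by apply: measurableT_comp => //; exact: measurable_avoid_prob.
  - exact: measurable_avoid_prob.
  - move=> x _; rewrite gee0_abs; last exact: stay_forever_ge0.
    by apply: avoid_prob_subset; apply: eball_subset; lra.
move/ae_eq_integral_abs : f0 => /(_ measurableT (measurable_avoid_prob _ _ _ _)).
apply: negligibleS => x [_ /eqP nz] /(_ I); exact: nz.
Qed.

Let rec_event s e : set Om :=
  [set w | forall N, exists n, (N <= n)%N /\ (enorm (p2sub (Sc n w) s) < e)%R].

(** At a time [n] when [X_n] is in the hitting set of radius [e / 2], choose a rational [q] within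
    [e / 2] of [s - S_n]. A later increment almost surely falls in [B(q, e / 2)], which brings the
    walk within [e] of [s]. *)
Lemma rec_set_of_hitting (mu : probability X R) :
  (forall r N, (0 < r)%R ->
     law mu [set w | forall k, (N <= k)%N -> ~ hitting_set r (Xc k.+1 w)] = 0) ->
  rec_set Sc Sg (law mu) = Sg.
Proof.
move=> muG; apply/seteqP; split => [s []//|s Ss]; split => // e e0.
have [cSg _ SgB _] := subSg.
have mSg : measurable Sg by exact: measurable_closed2.
pose r := (e / 2)%R; have r0 : (0 < r)%R by rewrite /r; lra.
pose late N := [set w | forall n, (N <= n)%N -> ~ eball s e (Sc n w)].
have mlate N : measurable (late N).
  exact: (measurable_avoid_from walk 0).
pose F n k := [set w | hitting_set r (Xc n w) /\
    eball (p2sub s (ratpoint R k)) r (Sc n w)] `&`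
  [set w | forall j, (0 <= j)%N -> ~ eball s e (Sc (n.+1 + j) w)].
(* On [F n k] the ball of radius [r] around [ratpoint R k], shifted by [S_n], lies in [B(s, e)]
   because [r + r = e]; from a point of the hitting set it is avoided with probability 0. *)
have muF n k : (exists t, Sg t /\ eball (ratpoint R k) r t) -> law mu (F n k) = 0.
  move=> gk.
  pose A := hitting_set r `*` eball (p2sub s (ratpoint R k)) r.
  have mA : measurable A.
    by apply: measurableX; [exact: measurable_hitting_set|exact: measurable_eball].
  rewrite (_ : F n k = [set w | A (Xc n w, Sc n w)] `&`
    [set w | forall j, avoid 0 (eball s e) j (Xc (n.+1 + j) w, Sc (n.+1 + j) w)])//.
  rewrite (law_hit_stay walk)//; last first.
    by move=> j; apply: measurable_avoid; exact: measurable_eball.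
  apply: integral0_eq => w [/= Gw Bw]; apply/eqP.
  rewrite eq_le stay_forever_ge0 andbT -(Gw k gk).
  apply: (avoid_prob_translate walk) => v; move: Bw; rewrite /eball /= => h1 h2.
  have -> : p2sub (p2add v (Sc n w)) s =
      p2add (p2sub v (ratpoint R k)) (p2sub (Sc n w) (p2sub s (ratpoint R k))).
    by rewrite /p2sub /p2add /=; congr pair; ring.
  by apply: le_lt_trans (enorm_add _ _) _; rewrite /r in h1 h2; lra.
(* [inSg] concerns point starts; a stay event constrained only at index [n], that is at time
   [n + 1], carries it over to [mu]. *)
have muS n : law mu [set w | ~ Sg (Sc n.+1 w)] = 0.
  pose C k : set (X * (R * R)) := [set z | k = n -> ~ Sg z.2].
  have mC k : measurable (C k).
    rewrite /C; have [->|kn] := eqVneq k n.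
      rewrite (_ : mkset _ = setT `*` ~` Sg).
        by apply: measurableX => //; exact: measurableC.
      by apply/seteqP; split => [z h|z [_ h] _]; [split => //; exact: h|exact: h].
    rewrite (_ : mkset _ = setT)//.
    by apply/seteqP; split => // z _ /= kn'; rewrite kn' eqxx in kn.
  have CE : [set w | ~ Sg (Sc n.+1 w)] =
      [set w | forall k, C k (Xc k.+1 w, Sc k.+1 w)].
    by apply/seteqP; split => [w h k ->|w /(_ n erefl)].
  rewrite CE; apply: (law_stay_null walk) => // x; rewrite -CE.
  have -> : [set w | ~ Sg (Sc n.+1 w)] = ~` [set w | Sg (Sc n.+1 w)] by [].
  rewrite probability_setC ?inSg ?subee//.
  by rewrite -[X in measurable X]setTI; exact: mSc.
have late0 N : law mu (late N) = 0.
  apply/negligibleP => //.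
  pose U1 := [set w | forall k, (N <= k)%N -> ~ hitting_set r (Xc k.+1 w)].
  pose U2 := \bigcup_n [set w | ~ Sg (Sc n.+1 w)].
  pose U3 := \bigcup_n \bigcup_k
    [set w | (exists t, Sg t /\ eball (ratpoint R k) r t) /\ F n k w].
  (* Either the hitting set is never visited after time [N], or at such a visit the walk is outside
     the group, or [s - S_n] is in the group and some rational ball around it puts the path in
     [F n k]. *)
  apply: (negligibleS (A := (U1 `|` (U2 `|` U3)))).
    move=> w lw; have [|/existsNP[n /not_implyP[Nn /contrapT Gn]]] :=
      pselect (forall k, (N <= k)%N -> ~ hitting_set r (Xc k.+1 w)); first by left.
    right; have [Sn|nSn] := pselect (Sg (Sc n.+1 w)); last by left; exists n.
    right; exists n.+1 => //.
    have [k hk] := dense_ratpoint (p2sub s (Sc n.+1 w)) r0.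
    exists k => //; split.
      by exists (p2sub s (Sc n.+1 w)); split; [exact: SgB|].
    split; last by move=> j _; apply: lw; lia.
    split => //; rewrite /eball /= -enorm_opp; move: hk; congr (enorm _ < _)%R.
    by rewrite /p2sub /=; congr pair; ring.
  apply: negligibleU; [|apply: negligibleU].
  - apply/negligibleP; last exact: muG.
    rewrite (_ : U1 = \bigcap_(k in [set k | (N <= k)%N])
      (Xc k.+1 @^-1` (~` hitting_set r)))//.
    apply: bigcap_measurableType => k _; rewrite -[X in measurable X]setTI.
    by apply: mXc => //; apply: measurableC; exact: measurable_hitting_set.
  - apply: negligible_bigcup => n; apply/negligibleP; last exact: muS.
    apply: (@measurableC _ _ (Sc n.+1 @^-1` Sg)).
    by rewrite -[X in measurable X]setTI; exact: mSc.
  - apply: negligible_bigcup => n; apply: negligible_bigcup => k.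
    have [gk|ngk] := pselect (exists t, Sg t /\ eball (ratpoint R k) r t).
      apply: (negligibleS (A := (F n k))); first by move=> w [].
      apply/negligibleP; last exact: muF.
      apply: measurableI; last exact: (measurable_avoid_from walk n.+1 0).
      apply: (@measurableI _ _ (Xc n @^-1` hitting_set r)).
        rewrite -[X in measurable X]setTI; apply: mXc => //.
        exact: measurable_hitting_set.
      exact: (measurable_visit walk).
    apply: (negligibleS (A := set0)); last exact: negligible_set0.
    by move=> w [].
have mrec : measurable (\bigcup_N late N) by exact: bigcupT_measurable.
have recE : rec_event s e = ~` \bigcup_N late N.
  apply/seteqP; split => w.
    by move=> h [N _ lN]; have [n [Nn nw]] := h N; exact: (lN n Nn).
  move=> h N; apply: contrapT => nN; apply: h; exists N => // n Nn nw.
  by apply: nN; exists n.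
have lates0 : law mu (\bigcup_N late N) = 0.
  apply/negligibleP => //; apply: negligible_bigcup => N.
  by apply/negligibleP; [exact: mlate|exact: late0].
by rewrite -/(rec_event s e) recE probability_setC// lates0 sube0.
Qed.

(** One time suffices: by stationarity [X_(N+1)] is outside the hitting set with probability 0. *)
Lemma rec_set_invariant :
  (forall A, measurable A -> \int[pi]_x Qker P x A = pi A) ->
  rec_set Sc Sg (law pi) = Sg.
Proof.
move=> inv; apply: rec_set_of_hitting => r N r0.
apply/eqP; rewrite -measure_le0 -(hitting_setC_null r0).
have mG := measurableC (measurable_hitting_set r).
rewrite -(law_stationary walk N.+1 inv mG).
apply: le_measure; rewrite ?inE.
- rewrite (_ : mkset _ = \bigcap_(k in [set k | (N <= k)%N])
    (Xc k.+1 @^-1` (~` hitting_set r)))//.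
  apply: bigcap_measurableType => k _; rewrite -[X in measurable X]setTI.
  exact: mXc.
- by rewrite -[X in measurable X]setTI; exact: mXc.
- by move=> w h; exact: h.
Qed.

(** The hitting set has [pi]-measure 1, so Harris recurrence applies to it for point starts, and
    [law_stay_null] passes to [mu]. *)
Lemma rec_set_harris (mu : probability X R) :
  harris_recurrent Xc law pi -> rec_set Sc Sg (law mu) = Sg.
Proof.
move=> harris; apply: rec_set_of_hitting => r N r0.
have mG := measurable_hitting_set r.
pose C k : set (X * (R * R)) := [set z | (N <= k)%N -> ~ hitting_set r z.1].
have mC k : measurable (C k).
  rewrite /C; have [Nk|kN] := leqP N k.
    rewrite (_ : mkset _ = ~` hitting_set r `*` setT).
      by apply: measurableX => //; exact: measurableC.
    by apply/seteqP; split => [z h|z [h _] _]; [split => //; exact: h|exact: h].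
  rewrite (_ : mkset _ = setT)//.
  by apply/seteqP; split => // z _ /= h; rewrite leqNgt kN in h.
rewrite (_ : mkset _ = [set w | forall k, C k (Xc k.+1 w, Sc k.+1 w)])//.
apply: (law_stay_null walk) => // x.
have Gpos : 0 < pi (hitting_set r).
  have := hitting_setC_null r0; rewrite probability_setC// => h.
  rewrite lt_neqAle measure_ge0 andbT; apply/eqP => pG0.
  by move: h; rewrite -pG0 sube0 => /eqP; rewrite onee_eq0.
have := harris _ x mG Gpos.
set io := mkset _ => ioE.
have mio : measurable io.
  rewrite (_ : io = \bigcap_M \bigcup_(k in [set k | (M <= k)%N])
      (Xc k @^-1` hitting_set r)).
    apply: bigcapT_measurable => M; apply: bigcup_measurable => k _.
    by rewrite -[X in measurable X]setTI; exact: mXc.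
  apply/seteqP; split => [w h M _|w h M].
    by have [k [Mk Gk]] := h M; exists k.
  by have [k Mk Gk] := h M I; exists k.
apply/eqP; rewrite -measure_le0.
have <- : law (pdirac R x) (~` io) = 0.
  by rewrite probability_setC// ioE subee.
apply: le_measure; rewrite ?inE.
- exact: (measurable_stay_event walk).
- exact: measurableC.
(* A visit at a time at least [N + 1] has the form [k.+1] with [N <= k], as the constraint
   requires. *)
- move=> w h iow; have [[|k] [Nk Gk]] := iow N.+1 => //.
  exact: (h k Nk).
Qed.

End hitting.

Unset Implicit Arguments.

Theorem theoremI (d : measure_display) (X : measurableType d) (R : realType)
  (dO : measure_display) (Om : measurableType dO)
  (P : R.-pker (X * (R * R))%type ~> (X * (R * R))%type)
  (Xc : nat -> Om -> X) (Sc : nat -> Om -> (R * R)%type)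
  (law : probability X R -> probability Om R)
  (pi : probability X R) (Sg : set (R * R))
  (m : {measure set (R * R)%type -> \bar R}) :
  is_MRW P Xc Sc law ->
  (* pi is an invariant probability of the driving kernel Q *)
  (forall A : set X, measurable A -> (\int[pi]_x Qker P x A)%E = pi A) ->
  (* S_1 is P_(pi,0)-integrable with E_(pi,0)[S_1] = 0 *)
  (law pi).-integrable setT (fun w => ((Sc 1 w).1)%:E) ->
  (law pi).-integrable setT (fun w => ((Sc 1 w).2)%:E) ->
  (\int[law pi]_w ((Sc 1 w).1)%:E)%E = 0%E ->
  (\int[law pi]_w ((Sc 1 w).2)%:E)%E = 0%E ->
  (* Sg is a two-dimensional closed subgroup carrying the walk *)
  closed_subgroup2 Sg ->
  (forall (x : X) (n : nat), law (pdirac R x) [set w | Sg (Sc n w)] = 1%E) ->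
  (* m is a Haar measure of Sg *)
  haar_on Sg m ->
  (* hypothesis (LL0) *)
  (exists epsS : R, 0 < epsS /\
   exists a : nat -> R,
     [/\ (forall n, (0 < n)%N -> 0 < a n),
         (\sum_(1 <= n <oo) (a n)%:E)%E = +oo%E &
         forall (s : R * R) (eps : R), Sg s -> 0 < eps -> eps < epsS ->
         forall f : X -> R, measurable_fun setT f -> (forall x, 0 <= f x) ->
         (exists M : R, forall x, f x <= M) ->
         ((fun n => (\int[law pi]_w (f (Xc n w) * \1_(eball s eps) (Sc n w))%:E)
                     * ((a n)^-1)%:E)%E @ \oo
          --> ((\int[pi]_x (f x)%:E) * m (eball s eps))%E)]) ->
  rec_set Sc Sg (law pi) = Sg /\
  (harris_recurrent Xc law pi ->
   forall mu : probability X R, rec_set Sc Sg (law mu) = Sg).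

Proof.
move=> walk inv _ _ _ _ subSg inSg haarSg [epsS [epsS0 [a [a0 aoo LL0]]]].
have hit := hit_everywhere walk subSg haarSg epsS0 a0 aoo LL0.
split; first exact: (rec_set_invariant walk subSg inSg hit).
by move=> harris mu; exact: (rec_set_harris walk subSg inSg hit).
Qed.
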